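(* Let $K$ be a field and $\Delta$ a simplicial complex on $[n]$. The following conditions are equivalent: (i) the vertex cover algebra $A(\Gamma)$ is standard graded for all subcomplexes $\Gamma\subseteq\Delta$; (ii) the vertex cover algebra $A(\Gamma)$ has no generator of degree $2$ for all subcomplexes $\Gamma\subseteq\Delta$; (iii) $\Delta$ has no special odd cycle.
   Context: $\mathbb{N}=\{0,1,2,\ldots\}$ and $[n]=\{1,\ldots,n\}$. A simplicial complex on $[n]$ is a collection of subsets of $[n]$ (faces) closed under taking subsets; its maximal faces are its facets, and $\mathcal{F}(\Delta)$ is the set of facets. Complexes have at least one facet and their facets are nonempty. A subcomplex $\Gamma\subseteq\Delta$ means a simplicial complex all of whose facets are facets of $\Delta$. For $k\ge 0$, a vector $\mathbf{c}=(c_1,\ldots,c_n)\in\mathbb{N}^n$ is a $k$-cover of $\Delta$ if $\sum_{i\in F}c_i\ge k$ for all $F\in\mathcal{F}(\Delta)$. Let $S=K[x_1,\ldots,x_n]$, let $t$ be a new variable, and let $A_k(\Delta)$ be the $K$-span of all monomials $x_1^{c_1}\cdots x_n^{c_n}t^k$ with $(c_1,\ldots,c_n)$ a $k$-cover of $\Delta$. The vertex cover algebra is the graded $S$-algebra $A(\Delta)=\bigoplus_{k\ge 0}A_k(\Delta)\subseteq S[t]$ (so $A_0(\Delta)=S$). It is called standard graded if it is generated over $S$ by $A_1(\Delta)$. ''No generator of degree $2$'' means that a minimal homogeneous system of generators of the $S$-algebra $A(\Delta)$ contains no element of $t$-degree $2$. An $s$-cycle of $\Delta$ ($s\ge2$)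 is an alternating sequence $v_1,F_1,v_2,F_2,\ldots,v_s,F_s,v_{s+1}=v_1$ with $v_1,\ldots,v_s$ distinct vertices and $F_1,\ldots,F_s$ distinct facets of $\Delta$ such that $v_i,v_{i+1}\in F_i$ for $i=1,\ldots,s$. The cycle is special if none of its facets $F_1,\ldots,F_s$ contains more than two of the vertices $v_1,\ldots,v_s$. It is odd if $s$ is odd. *)

(* Defs.v *)
From mathcomp Require Import all_boot all_order all_algebra.
From mathcomp Require Import mpoly.

Set Implicit Arguments.
Unset Strict Implicit.
Unset Printing Implicit Defensive.

Import GRing.Theory.
Local Open Scope ring_scope.

Section Complexes.

Variable n : nat.
Implicit Types (D G : {set {set 'I_n}}) (F : {set 'I_n}).

Definition facets D : {set {set 'I_n}} :=
  [set F | maxset (fun X => X \in D) F].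

Definition simplicial_complex D : Prop :=
  [/\ forall F F', F \in D -> F' \subset F -> F' \in D,
      facets D != set0
    & set0 \notin facets D].

Definition subcomplex G D : Prop :=
  simplicial_complex G /\ facets G \subset facets D.

(* Vectors of N^n are represented by multinomials. *)
Definition kcover D (k : nat) (c : 'X_{1..n}) : bool :=
  [forall F in facets D, (k <= \sum_(i in F) c i)%N].

(* Indices are counted from 0; [ordS] is the successor modulo [s]. *)
Definition is_cycle D (s : nat) (v : 'I_s -> 'I_n) (F : 'I_s -> {set 'I_n}) :
    Prop :=
  [/\ (2 <= s)%N, injective v, injective F,
      forall i, F i \in facets D
    & forall i, v i \in F i /\ v (ordS i) \in F i].

Definition special_cycle D (s : nat) (v : 'I_s -> 'I_n)
    (F : 'I_s -> {set 'I_n}) : Prop :=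
  is_cycle D v F /\ forall i, (#|F i :&: [set v j | j : 'I_s]| <= 2)%N.

Definition has_special_odd_cycle D : Prop :=
  exists (s : nat) (v : 'I_s -> 'I_n) (F : 'I_s -> {set 'I_n}),
    odd s /\ special_cycle D v F.

End Complexes.

Section Generators.

Variables (R : comNzRingType) (B : algType R).

(* The R-subalgebra of B generated by X. *)
Inductive subalg_gen (X : B -> Prop) : B -> Prop :=
| subalg_gen_scalar (a : R) : subalg_gen X a%:A
| subalg_gen_mem (x : B) : X x -> subalg_gen X x
| subalg_gen_add (x y : B) :
    subalg_gen X x -> subalg_gen X y -> subalg_gen X (x + y)
| subalg_gen_mul (x y : B) :
    subalg_gen X x -> subalg_gen X y -> subalg_gen X (x * y).

Definition generates (X A : B -> Prop) : Prop :=
  forall x, A x <-> subalg_gen X x.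

(* X is inclusion-minimal among the generating systems of the R-algebra
   A = (+)_k A_ k consisting of homogeneous elements. *)
Definition minimal_homogeneous_generators
    (A_ : nat -> B -> Prop) (A X : B -> Prop) : Prop :=
  [/\ forall x, X x -> exists k, A_ k x,
      generates X A
    & forall Y : B -> Prop,
        (forall y, Y y -> X y) -> generates Y A -> forall x, X x -> Y x].

End Generators.

Section VertexCoverAlgebra.

Variables (K : fieldType) (n : nat) (D : {set {set 'I_n}}).

Local Notation S := {mpoly K[n]}.

(* The ring S[t] is {poly S}, with t = 'X. *)
Definition cover_piece (k : nat) (p : {poly S}) : Prop :=
  exists (cs : seq 'X_{1..n}) (a : 'X_{1..n} -> K),
    all (kcover D k) cs /\
    p = \sum_(c <- cs) (a c *: 'X_[c] : S) *: 'X^k.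

Definition cover_algebra (p : {poly S}) : Prop :=
  exists (m : nat) (f : nat -> {poly S}),
    (forall k, cover_piece k (f k)) /\ p = \sum_(k < m) f k.

Definition standard_graded : Prop :=
  generates (cover_piece 1) cover_algebra.

(* Minimal systems do not contain 0, so membership in the piece of degree 2
   means having t-degree 2. Whether such a generator occurs does not depend on
   the minimal system. *)
Definition no_generator_of_degree_2 : Prop :=
  forall X : {poly S} -> Prop,
    minimal_homogeneous_generators cover_piece cover_algebra X ->
    forall x, X x -> ~ cover_piece 2 x.

End VertexCoverAlgebra.

(* Main.v *)
Require Import Defs.
From mathcomp Require Import all_boot all_order all_algebra.
From mathcomp Require Import mpoly zify.
From Stdlib Require Import Classical.

(** A complex without special odd cycle is a balanced hypergraph in the sense
    of Berge, and the algebraic conditions are statements about the monoid of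
    pairs (k, c) with c a k-cover, whose monomials span the cover algebra.

    Absence of special odd cycles makes the algebra standard graded.  Balanced
    hypergraphs are bicolorable on every vertex subset A ([bicoloring]): the
    vertices of A can be given two colors so that each facet meeting A twice
    sees both.  Applied to the odd coordinates of a vector d, this halves d
    into two vectors that both cover every facet of weight at least 2
    ([weight_bisection]).  Given a k-cover c, write c as a sum of k arbitrary
    vectors; while one of them misses a facet, another has weight at least 2
    there, and redistributing these two by bisection strictly increases the
    number of pairs (facet, vector covering it).  The process stops at a sum of
    k 1-covers ([cover_decomposition]), so each monomial of degree k is a
    product of k monomials of degree 1.  The hypothesis passes to subcomplexes.

    Standard graded excludes generators of degree 2: the part of degree 1 of
    an algebra generated by a homogeneous set X only needs the members of X of
    degree 1, so a member of degree 2 can be dropped from X.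

    Conversely, for a special odd cycle take the subcomplex formed by its s
    facets.  The indicator c of the cycle vertices is a 2-cover.  A 1-cover
    supported on the cycle has total weight at least s/2, since each vertex
    lies in two of the facets; as s is odd, two 1-covers weigh more than s
    together and cannot sum to c.  Hence the monomial of c is indecomposable,
    and the indecomposable monomials are a minimal system of homogeneous
    generators ([indecomposable_monomials_minimal]). *)

Set Implicit Arguments.
Unset Strict Implicit.
Unset Printing Implicit Defensive.

Import GRing.Theory.

(** * Odd cycles and non-cut vertices of graphs *)

Definition vertex_deleted (T : finType) (e : rel T) (x : T) : rel T :=
  [rel a b | [&& a != x, b != x & e a b]].

(** Among all edges x r, choose one for which the component of r in the graph
    without x is as large as possible.  A neighbor u of x outside of this
    component would give a larger one: that of x in the graph without u. *)
Lemma nonisolated_noncut_vertex (T : finType) (e : rel T) (a b : T) :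
    ssrbool.symmetric e -> irreflexive e -> e a b ->
  exists x r, e x r /\
    forall u, e x u -> connect (vertex_deleted e x) r u.
Proof.
move=> esym eirr eab.
pose comp (z : T * T) := [pred y | connect (vertex_deleted e z.1) z.2 y].
have [[x r] /= exr max_xr] :=
  @arg_maxnP _ (a, b) (fun z => e z.1 z.2) (fun z => #|comp z|) eab.
exists x, r; split=> // u exu; apply/negPn/negP => nCu.
have rx : r != x by apply: contraL exr => /eqP->; rewrite eirr.
have xu : x != u by apply: contraL exu => /eqP->; rewrite eirr.
have ru : r != u by apply: contraNneq nCu => <-; exact: connect0.
have eux : e u x by rewrite esym.
suff /proper_card : comp (x, r) \proper comp (u, x).
  by rewrite ltnNge (max_xr (u, x) eux).
have xr_u : vertex_deleted e u x r by apply/and3P.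
apply/properP; split; last first.
  exists x; rewrite !inE ?connect0 //=.
  apply/connectP => -[p]; elim/last_ind: p => [_ /eqP|p y _].
    by rewrite eq_sym (negPf rx).
  rewrite rcons_path last_rcons => /andP[_ /and3P[_ yx _]] xy.
  by rewrite xy eqxx in yx.
apply/subsetP => y; rewrite !inE /= => /connectP[p pP ->].
apply: connect_trans (connect1 xr_u) _.
have reach_neq q : path (vertex_deleted e x) r q -> last r q != u.
  by move=> qP; apply: contraNneq nCu => <-; apply/connectP; exists q.
elim/last_ind: p pP => [|p z IHp] pP; first exact: connect0.
have /= := reach_neq _ pP; move: pP; rewrite rcons_path last_rcons.
case/andP=> pP /and3P[_ _ epz] zu.
apply: connect_trans (IHp pP) (connect1 _).
by apply/and3P; split=> //; apply: reach_neq.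
Qed.

Lemma proper_coloring_path (T : eqType) (e : rel T) (f : T -> bool) u p :
    (forall a b, e a b -> f a != f b) -> path e u p ->
  f (last u p) = f u (+) odd (size p).
Proof.
move=> fP; elim: p u => [|v p IHp] u /=; first by rewrite addbF.
case/andP=> /fP fuv /IHp ->.
by move: fuv; do 2!case: (f _) => //=; rewrite ?negbK.
Qed.

(** * Bicoloring of balanced complexes *)

Section Balanced.

Variables (n : nat) (D : {set {set 'I_n}}).
Implicit Types (A F : {set 'I_n}) (c d : 'X_{1..n}).

(** In a bicoloring of [A] these are the pairs whose ends are forced to have
    different colors. *)
Definition trace_edge A : rel 'I_n :=
  [rel x y | (x != y) && [exists F in facets D, F :&: A == [set x; y]]].

Lemma trace_edge_sym A : ssrbool.symmetric (trace_edge A).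
Proof. by move=> x y; rewrite /trace_edge /= eq_sym setUC. Qed.

Lemma trace_edge_irr A : irreflexive (trace_edge A).
Proof. by move=> x; rewrite /trace_edge /= eqxx. Qed.

Lemma trace_edge_mem A x y : trace_edge A x y -> x \in A.
Proof.
case/andP=> _ /exists_inP[F _ /eqP FA].
have : x \in F :&: A by rewrite FA set21.
by rewrite inE => /andP[].
Qed.

(** The facets realizing the edges of such a cycle contain no further vertex
    of [A], which makes the cycle special; they are distinct because the
    vertex pairs are, the length being at least 3. *)
Lemma special_odd_cycle_of_trace_cycle A (q : seq 'I_n) :
    uniq q -> cycle (trace_edge A) q -> odd (size q) -> (1 < size q)%N ->
  has_special_odd_cycle D.
Proof.
move=> uq cq oq sq.
have [x0 _] : exists x0, x0 \in q.
  by case: (q) sq => // a l _; exists a; rewrite mem_head.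
pose v (i : 'I_(size q)) := nth x0 q i.
have v_inj : injective v.
  by move=> i j /eqP; rewrite nth_uniq // => /eqP; apply: val_inj.
have edge i : trace_edge A (v i) (v (ordS i)).
  rewrite /v /=; case: (q) cq i => [|a l] /= cq i; first by case: i.
  have := pathP x0 cq i; rewrite size_rcons ltn_ord => /(_ isT).
  have := ltn_ord i => /=; rewrite ltnS leq_eqVlt => /orP[/eqP il|il].
    rewrite il modnn /= -rcons_cons nth_rcons /= ltnSn.
    by rewrite nth_rcons ltnn eqxx.
  by rewrite modn_small //= -rcons_cons !nth_rcons /= il ltnS ltnW.
have [F FP] : exists F : 'I_(size q) -> {set 'I_n}, forall i,
    F i \in facets D /\ F i :&: A = [set v i; v (ordS i)].
  apply: (@fin_all_exists _ (fun=> {set 'I_n}) (fun i Fi => Fi \in facets D /\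
     Fi :&: A = [set v i; v (ordS i)])) => i.
  by have /andP[_ /exists_inP[G GD /eqP GA]] := edge i; exists G.
have vA i : v i \in A := trace_edge_mem (edge i).
exists (size q), v, F; split=> //; split; first split=> //.
- move=> i j Fij; have := FP i; have := FP j; rewrite Fij => -[_ ->] [_ Eij].
  have /set2P[/v_inj -> //|/v_inj ij] : v i \in [set v j; v (ordS j)].
    by rewrite Eij set21.
  have /set2P[/v_inj ji|] : v j \in [set v i; v (ordS i)].
  - by rewrite -Eij set21.
  - by [].
  (* Now [i] and [j] are cyclic successors of each other. *)
  move=> /v_inj ji; have := congr1 val ij; have := congr1 val ji.
  have succ_mod (k : 'I_(size q)) :
      k.+1 %% size q = if k.+1 == size q then 0 else k.+1.
    case: eqP => [->|ks]; first by rewrite modnn.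
    by rewrite modn_small //; have := ltn_ord k; lia.
  rewrite /= !succ_mod; move: oq sq; case: eqP => ?; case: eqP => ?; lia.
- by move=> i; case: (FP i).
- move=> i; have [_ E] := FP i.
  by split; apply: (subsetP (subsetIl _ A)); rewrite E ?set21 ?set22.
move=> i; have [_ E] := FP i.
apply: leq_trans (_ : #|[set v i; v (ordS i)]| <= 2)%N; last first.
  by rewrite cards2; case: (_ != _).
rewrite -E; apply/subset_leq_card/setIS.
by apply/subsetP => _ /imsetP[j _ ->].
Qed.

(** Berge's theorem, by induction on the size of [A].  Remove a vertex [x] such
    that the neighbors of [x] in the graph [trace_edge A] stay connected
    without it, and color the rest.  All neighbors of [x] get the same color:
    otherwise a simple path between two neighbors of different colors has an
    odd number of edges and closes up through [x] to an odd cycle.  Hence [x]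
    can take the opposite color, and the facets meeting [A] in [x] and at least
    two more vertices already see both colors. *)
Lemma bicoloring A : ~ has_special_odd_cycle D ->
  exists f : 'I_n -> bool, forall F, F \in facets D -> (1 < #|F :&: A|)%N ->
    forall b, exists2 x, x \in F :&: A & f x = b.
Proof.
move=> balanced; have [m] := ubnP #|A|; elim: m A => // m IHm A ltAm.
have [->|[x1 x1A]] := set_0Vmem A.
  by exists xpredT => F _; rewrite setI0 cards0.
have [x [xA xP]] : exists x, x \in A /\ forall u w, trace_edge A x u ->
    trace_edge A x w -> connect (vertex_deleted (trace_edge A) x) u w.
  have [/existsP[a /existsP[b eab]]|noedge] :=
      boolP [exists a, exists b, trace_edge A a b]; last first.
    exists x1; split=> // u w eu _; case/existsP: noedge.
    by exists x1; apply/existsP; exists u.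
  have [x [r [exr xP]]] := nonisolated_noncut_vertex (@trace_edge_sym A)
     (@trace_edge_irr A) eab.
  exists x; split; first exact: trace_edge_mem exr.
  have dsym : ssrbool.symmetric (vertex_deleted (trace_edge A) x).
    by move=> y z; rewrite /vertex_deleted /= trace_edge_sym andbCA.
  move=> u w /xP ru /xP; apply: connect_trans.
  by rewrite (sym_connect_sym dsym).
have [|f fP] := IHm (A :\ x); first by move: ltAm; rewrite (cardsD1 x) xA; lia.
have setIDx F : x \notin F -> F :&: (A :\ x) = F :&: A.
  move=> xF; apply/setP => y; rewrite !inE; case: eqP => [->|] //=.
  by rewrite (negPf xF).
have f_edge a b : vertex_deleted (trace_edge A) x a b -> f a != f b.
  case/and3P=> ax bx /andP[ab /exists_inP[F FD /eqP FA]].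
  have xF : x \notin F.
    apply/negP => xF; have : x \in F :&: A by rewrite inE xF.
    by rewrite FA !inE ![x == _]eq_sym (negPf ax) (negPf bx).
  have := fP F FD; rewrite setIDx // FA cards2 ab => /(_ isT) fab.
  have [y /set2P yab fy] := fab (~~ f a).
  by case: yab fy => ->; case: (f a); case: (f b).
have const u w : trace_edge A x u -> trace_edge A x w -> f u = f w.
  move=> eu ew; apply/eqP/negPn/negP => fuw; apply: balanced.
  case/connectP: (xP u w eu ew) => p0 /shortenP[p pP up _] wE.
  have xup : x \notin u :: p.
    rewrite inE negb_or; apply/andP; split.
      by apply: contraTneq eu => <-; rewrite trace_edge_irr.
    elim: (p) (u) pP {up wE} => //= y l IHl z /andP[/and3P[_ yx _] /IHl].
    by rewrite inE negb_or eq_sym yx.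
  apply: (@special_odd_cycle_of_trace_cycle A (x :: u :: p)) => //=.
  - by rewrite xup.
  - rewrite eu rcons_path -wE trace_edge_sym ew andbT.
    by apply: sub_path pP => y z /and3P[].
  rewrite negbK; move: (proper_coloring_path f_edge pP) fuw; rewrite -wE => ->.
  by case: (f u); case: (odd _).
pose cx := if [pick u | trace_edge A x u] is Some u then ~~ f u else true.
have cxP u : trace_edge A x u -> f u = ~~ cx.
  rewrite /cx => eu; case: pickP => [w ew|/(_ u)]; last by rewrite eu.
  by rewrite negbK; apply: const.
clearbody cx.
exists (fun y => if y == x then cx else f y) => F FD cardF b.
have [xF|xF] := boolP (x \in F); last first.
  move: cardF; rewrite -setIDx // => /(fP F FD) /(_ b)[y yF fy].
  by exists y => //; case: eqP yF => // ->; rewrite !inE eqxx andbF.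
have xFA : x \in F :&: A by rewrite inE xF.
have defFx : F :&: (A :\ x) = (F :&: A) :\ x by rewrite setIDA.
have [big|small] := ltnP 1 #|F :&: (A :\ x)|.
  have [y] := fP F FD big b; rewrite defFx inE => /andP[yx yFA] fy.
  by exists y => //; case: eqP yx fy => // ->; rewrite inE eqxx.
have /cards1P[u Eu] : #|F :&: (A :\ x)| == 1%N.
  by move: cardF small; rewrite defFx (cardsD1 x) xFA; lia.
have xu : u != x.
  by have := set11 u; rewrite -Eu !inE => /and3P[].
have FA : F :&: A = [set x; u].
  by rewrite -(setD1K xFA) -defFx Eu.
have eu : trace_edge A x u.
  by rewrite /trace_edge /= eq_sym xu; apply/exists_inP; exists F; rewrite ?FA.
have [<-|nb] := eqVneq cx b; first by exists x; rewrite ?eqxx.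
exists u; first by rewrite FA set22.
by rewrite (negPf xu) (cxP u eu); case: (cx) (b) nb => [] [].
Qed.

(** * Decomposition of covers *)

Definition weight F c := (\sum_(i in F) c i)%N.

Lemma weightD F c d : weight F (c + d)%MM = (weight F c + weight F d)%N.
Proof. by rewrite /weight -big_split; apply: eq_bigr => i _; rewrite mnmDE. Qed.

Lemma weight_sum F (l : seq 'X_{1..n}) :
  weight F (\big[+%MM/0%MM]_(d <- l) d) = (\sum_(d <- l) weight F d)%N.
Proof.
elim: l => [|d l IHl]; last by rewrite !big_cons weightD IHl.
by rewrite !big_nil /weight big1 // => i _; rewrite mnm0E.
Qed.

Lemma weight_gt0 F c i : i \in F -> (0 < c i)%N -> (0 < weight F c)%N.
Proof. by move=> iF ci; rewrite /weight (bigD1 i) //= addn_gt0 ci. Qed.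

(** Both parts receive half of each coordinate, rounded down, and the units
    left over at odd coordinates are shared out by a bicoloring. *)
Lemma weight_bisection d : ~ has_special_odd_cycle D ->
  exists d1 d2, d = (d1 + d2)%MM /\ forall F, F \in facets D ->
    (1 < weight F d)%N -> (0 < weight F d1)%N /\ (0 < weight F d2)%N.
Proof.
move=> balanced; have [f fP] := bicoloring [set i | odd (d i)] balanced.
pose part b := [multinom ((d i)./2 + (odd (d i) && (f i == b)))%N | i < n].
exists (part true), (part false); split=> [|F FD dF].
  apply/mnmP => i; rewrite mnmDE !mnmE -[LHS]odd_double_half.
  by case: (f i); case: (odd _) => /=; lia.
suff partF b : (0 < weight F (part b))%N by [].
have [/exists_inP[i iF di]|/exists_inPn small] :=
  boolP [exists i in F, 1 < d i]%N.
  by apply: (weight_gt0 iF); rewrite mnmE addn_gt0 half_gt0 di.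
(* All coordinates of [d] on [F] are 0 or 1, so that the weight counts the odd
   ones and the bicoloring applies. *)
have [|i] := fP F FD _ b; last first.
  rewrite !inE => /andP[iF di] fi; apply: (weight_gt0 iF).
  by rewrite mnmE di fi eqxx addn1.
suff <- : weight F d = #|F :&: [set i | odd (d i)]| by [].
rewrite -sum1_card (eq_bigl (fun i => (i \in F) && odd (d i))); last first.
  by move=> i; rewrite !inE.
rewrite big_mkcondr; apply: eq_bigr => i /small.
by case: (d i) => [|[|]].
Qed.

(** Start from [c] and [k] zero vectors, and bisect the sum of a vector [b]
    that misses a facet [F] and a vector [a] of weight at least 2 on [F].  This
    adds a pair of a facet and a vector covering it at [F], and loses none at
    any facet [G]: if [a + b] has weight at least 2 on [G] then both new
    vectors cover [G], and otherwise the weight on [G] is the number of the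
    two vectors that cover it, before and after. *)
Lemma cover_decomposition k c : ~ has_special_odd_cycle D ->
    kcover D k.+1 c ->
  exists l : seq 'X_{1..n}, [/\ size l = k.+1, all (kcover D 1) l
                              & c = \big[+%MM/0%MM]_(d <- l) d].
Proof.
move=> balanced c_cover.
pose covered l := \sum_(F in facets D) count (fun d => 0 < weight F d)%N l.
have [l0 [sl0 cl0]] : exists l,
    size l = k.+1 /\ c = \big[+%MM/0%MM]_(d <- l) d.
  exists (c :: nseq k 0%MM); rewrite /= size_nseq big_cons; split=> //.
  by rewrite big1_seq ?addm0 // => d /andP[_ /nseqP[]].
have [m] := ubnP (k.+1 * #|facets D| - covered l0).
elim: m l0 sl0 cl0 => // m IHm l sl cl ltm.
have [all_cover|] := boolP (all (kcover D 1) l); first by exists l.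
case/allPn => b bl /forall_inPn[F FD].
rewrite -ltnNge ltnS leqn0 -/(weight F b).
move=> /eqP bF.
have cF : (k < \sum_(d <- l) weight F d)%N.
  by rewrite -weight_sum -cl; exact: (forall_inP c_cover F FD).
have [a al aF] : exists2 a, a \in l & (1 < weight F a)%N.
  apply/hasP/negPn/negP => /hasPn small; move: cF; apply/negP; rewrite -leqNgt.
  move/perm_to_rem in bl; rewrite (perm_big _ bl) big_cons /= bF add0n.
  have <- : size (rem b l) = k by move: (perm_size bl); rewrite sl /= => -[].
  rewrite -sum1_size [leqLHS]big_seq [leqRHS]big_seq; apply: leq_sum => d dl.
  by rewrite leqNgt; apply: small; rewrite (perm_mem bl) inE dl orbT.
have ab : b \in rem a l.
  have := bl; rewrite (perm_mem (perm_to_rem al)) inE => /orP[/eqP ba|//].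
  by rewrite -ba bF in aF.
have pl : perm_eq l [:: a, b & rem b (rem a l)].
  by rewrite (permPl (perm_to_rem al)) perm_cons perm_to_rem.
set r := rem b _ in pl.
have [d1 [d2 [abE d12P]]] := weight_bisection (a + b)%MM balanced.
have sl' : size [:: d1, d2 & r] = k.+1 by rewrite -sl (perm_size pl).
apply: (IHm [:: d1, d2 & r]) => //.
- by rewrite cl (perm_big _ pl) !big_cons /= !addmA abE.
have bound l' : size l' = k.+1 -> (covered l' <= k.+1 * #|facets D|)%N.
  move=> <-; rewrite mulnC -sum_nat_const; apply: leq_sum => G _.
  exact: count_size.
suff lt : (covered l < covered [:: d1, d2 & r])%N.
  by apply: leq_trans (ltn_sub2l _ lt) ltm; apply: leq_trans lt (bound _ sl').
have weightE G : (weight G a + weight G b = weight G d1 + weight G d2)%N.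
  by rewrite -!weightD abE.
have coveredl : covered l = covered [:: a, b & r].
  by apply: eq_bigr => G _; apply: permP.
have mono G : G \in facets D ->
    ((0 < weight G a) + (0 < weight G b)
     <= (0 < weight G d1) + (0 < weight G d2))%N.
  move=> GD; have := d12P G GD; rewrite weightD; have := weightE G.
  case: (posnP (weight G a)); case: (posnP (weight G b)) => *; lia.
rewrite coveredl /covered (bigD1 F) //= [ltnRHS](bigD1 F) //= -addSn.
apply: leq_add; last first.
  by apply: leq_sum => G /andP[GD _] /=; rewrite !addnA leq_add2r mono.
have [|d1F d2F] := d12P F FD; first by rewrite weightD; lia.
by rewrite bF d1F d2F; case: (0 < weight F a)%N; lia.
Qed.

End Balanced.

(** * Monomials of the vertex cover algebra *)

Section SubalgebraGeneration.

Local Open Scope ring_scope.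

Variables (R : comNzRingType) (B : algType R).
Implicit Types (X Y : B -> Prop).

Lemma subalg_gen_scale X a x : subalg_gen X x -> subalg_gen X (a *: x).
Proof.
move=> Xx; rewrite -mulr_algl; apply: subalg_gen_mul => //.
exact: subalg_gen_scalar.
Qed.

Lemma subalg_gen_sum X (I : Type) (r : seq I) (P : pred I) (x : I -> B) :
    (forall i, P i -> subalg_gen X (x i)) ->
  subalg_gen X (\sum_(i <- r | P i) x i).
Proof.
move=> Xx; apply: big_ind => //; last exact: subalg_gen_add.
by rewrite -(scale0r 1); apply: subalg_gen_scalar.
Qed.

Lemma subalg_gen_trans X Y : (forall x, X x -> subalg_gen Y x) ->
  forall x, subalg_gen X x -> subalg_gen Y x.
Proof.
move=> XY x; elim=> [a|y /XY //|y z _ Yy _|y z _ Yy _].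
- exact: subalg_gen_scalar.
- exact: subalg_gen_add.
- exact: subalg_gen_mul.
Qed.

End SubalgebraGeneration.

Section CoverAlgebra.

Local Open Scope ring_scope.

Variables (K : fieldType) (n : nat) (D : {set {set 'I_n}}).
Local Notation S := {mpoly K[n]}.
Implicit Types (c d : 'X_{1..n}) (p q : {poly S}).

Definition tmonomial k c : {poly S} := ('X_[c] : S) *: 'X^k.

Lemma tmonomialM i j c d :
  tmonomial i c * tmonomial j d = tmonomial (i + j)%N (c + d)%MM.
Proof. by rewrite /tmonomial mpolyXD exprD -scalerAl -scalerAr scalerA. Qed.

Lemma coef_scaleXn (s : S) k j : (s *: 'X^k)`_j = if j == k then s else 0.
Proof.
rewrite coefZ coefXn; case: (j == k); first exact: mulr1.
exact: mulr0.
Qed.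

Lemma msupp_tmonomial k c j d :
  (d \in msupp (tmonomial k c)`_j) = (j == k) && (d == c).
Proof.
rewrite coef_scaleXn; case: (j == k); last by rewrite msupp0.
by rewrite msuppX inE.
Qed.

Lemma msupp_coefM p q k c : c \in msupp (p * q)`_k ->
  exists i j a b, [/\ k = (i + j)%N, c = (a + b)%MM,
                      a \in msupp p`_i & b \in msupp q`_j].
Proof.
rewrite coefM => /msupp_sum_le /flattenP[s /mapP[i _ ->]].
case/msuppM_le/allpairsP => -[a b] /= [pa qb ->].
by exists i, (k - i)%N, a, b; rewrite subnKC // -ltnS.
Qed.

Lemma kcoverP k c :
  reflect (forall F, F \in facets D -> (k <= weight F c)%N) (kcover D k c).
Proof. exact: forall_inP. Qed.

Lemma kcover0 c : kcover D 0 c.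
Proof. exact/kcoverP. Qed.

Lemma kcoverD i j c d :
  kcover D i c -> kcover D j d -> kcover D (i + j)%N (c + d)%MM.
Proof.
move=> /kcoverP ci /kcoverP dj; apply/kcoverP => F FD.
by rewrite weightD leq_add ?ci ?dj.
Qed.

Lemma cover_pieceP k p :
  cover_piece D k p <->
  exists2 s : S, p = s *: 'X^k & {in msupp s, forall c, kcover D k c}.
Proof.
split=> [[cs [a [/allP cs_cover ->]]]|[s -> s_cover]].
  rewrite -scaler_suml; eexists; first by [].
  move=> c; rewrite mcoeff_msupp => nz; apply: cs_cover.
  apply: contraNT nz => ncs.
  rewrite (raddf_sum (mcoeff c)) /= big1_seq // => d /andP[_ dcs].
  rewrite mcoeffZ mcoeffX; case: eqP dcs ncs => [-> ->//|_]; by rewrite mulr0.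
exists (msupp s), (fun c => s@_c); split; first exact/allP.
by rewrite -scaler_suml -mpolyE.
Qed.

Lemma cover_piece_tmonomial k c :
  kcover D k c -> cover_piece D k (tmonomial k c).
Proof.
move=> ck; apply/cover_pieceP; exists 'X_[c] => // d.
by rewrite msuppX inE => /eqP ->.
Qed.

(** Membership is decided by the support alone; this turns closure properties
    of the algebra into closure properties of the set of covers. *)
Lemma cover_algebraP p :
  cover_algebra D p <-> forall k, {in msupp p`_k, forall c, kcover D k c}.
Proof.
split=> [[m [f [fP ->]]]|p_cover].
  apply: (big_ind (fun p => forall k, {in msupp p`_k, forall c, kcover D k c})).
  - by move=> k c; rewrite coef0 msupp0.
  - move=> q r qP rP k c; rewrite coefD => /msuppD_le; rewrite mem_cat.
    by case/orP; [apply: qP | apply: rP].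
  move=> i _ k c; have /cover_pieceP[s -> s_cover] := fP i.
  rewrite coef_scaleXn; case: eqP => [->|_]; first exact: s_cover.
  by rewrite msupp0.
exists (size p), (fun k => p`_k *: 'X^k).
split; last by rewrite -poly_def coefK.
by move=> k; apply/cover_pieceP; exists p`_k => // c; apply: p_cover.
Qed.

Lemma cover_piece_algebra k p : cover_piece D k p -> cover_algebra D p.
Proof.
case/cover_pieceP=> s -> s_cover; apply/cover_algebraP => i c.
rewrite coef_scaleXn; case: eqP => [->|_]; first exact: s_cover.
by rewrite msupp0.
Qed.

Lemma subalg_gen_cover_algebra (X : {poly S} -> Prop) :
    (forall x, X x -> exists k, cover_piece D k x) ->
  forall p, subalg_gen X p -> cover_algebra D p.
Proof.
move=> XA p; elim=> [a|x /XA[k]|q r _ /cover_algebraP qP _ /cover_algebraP rP|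
                     q r _ /cover_algebraP qP _ /cover_algebraP rP].
- apply/cover_algebraP => k c; rewrite coefZ coef1; case: eqP => [->|_].
    by rewrite kcover0.
  by rewrite mulr0 msupp0.
- exact: cover_piece_algebra.
- apply/cover_algebraP => k c; rewrite coefD => /msuppD_le; rewrite mem_cat.
  by case/orP; [apply: qP | apply: rP].
apply/cover_algebraP => k c /msupp_coefM[i [j [a [b [-> -> pa qb]]]]].
by apply: kcoverD; [apply: qP | apply: rP].
Qed.

Lemma cover_algebra_sub_gen (X : {poly S} -> Prop) :
    (forall k c, kcover D k c -> subalg_gen X (tmonomial k c)) ->
  forall p, cover_algebra D p -> subalg_gen X p.
Proof.
move=> Xmono p /cover_algebraP p_cover.
rewrite -[p]coefK poly_def; apply: subalg_gen_sum => k _.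
rewrite [p`_k]mpolyE scaler_suml big_seq.
apply: subalg_gen_sum => c /p_cover ck.
rewrite -mul_mpolyC -scalerA; apply: subalg_gen_scale; exact: Xmono.
Qed.

Lemma tmonomial0 (X : {poly S} -> Prop) c : subalg_gen X (tmonomial 0 c).
Proof. by rewrite /tmonomial expr0; apply: subalg_gen_scalar. Qed.

Lemma standard_graded_of_balanced :
  ~ has_special_odd_cycle D -> standard_graded K D.
Proof.
move=> balanced p; split; last first.
  by apply: subalg_gen_cover_algebra => x; exists 1%N.
apply: cover_algebra_sub_gen => -[|k] c ck; first exact: tmonomial0.
have [l [<- l_cover ->]] := cover_decomposition balanced ck.
elim: l l_cover {ck} => [_|d l IHl /andP[d1 /IHl gl]].
  by rewrite big_nil; apply: tmonomial0.
rewrite big_cons /= -[(size l).+1]add1n -tmonomialM.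
apply: subalg_gen_mul => //.
by apply: subalg_gen_mem; apply: cover_piece_tmonomial.
Qed.

(** * Generators of degree 2 *)

(** In a product, the coefficient of t involves only the coefficients of 1 and
    t of the factors.  So the linear part of an element generated by [X] is
    generated by the members of [X] of degree 1, and a generator [x] of degree
    2 is superfluous as soon as degree 1 generates everything. *)
Lemma no_generator_of_standard_graded :
  standard_graded K D -> no_generator_of_degree_2 K D.
Proof.
move=> std X [Xhom Xgen Xmin] x Xx /cover_pieceP[s xE _].
pose Y (y : {poly S}) := X y /\ y <> x.
suff Ygen : generates Y (cover_algebra D).
  by have [] := Xmin Y (fun y => @proj1 _ _) Ygen x Xx.
have linear_part p : subalg_gen X p -> subalg_gen Y (p`_1 *: 'X).
  elim=> [a|y Xy|y z _ Yy _ Yz|y z _ Yy _ Yz].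
  - rewrite coefZ coef1 mulr0 scale0r -(scale0r 1); exact: subalg_gen_scalar.
  - have [k /cover_pieceP[r yE _]] := Xhom y Xy.
    (* The linear part of [x] itself vanishes since its degree is 2. *)
    have [yx|/eqP yx] := eqVneq y x.
      rewrite yx xE coef_scaleXn scale0r -(scale0r 1).
      exact: subalg_gen_scalar.
    have [k1|k1] := eqVneq k 1%N.
      have -> : y`_1 *: 'X = y by rewrite yE k1 coef_scaleXn.
      exact: subalg_gen_mem.
    rewrite yE coef_scaleXn eq_sym (negPf k1) scale0r -(scale0r 1).
    exact: subalg_gen_scalar.
  - by rewrite coefD scalerDl; apply: subalg_gen_add.
  rewrite coefM !big_ord_recl big_ord0 addr0 /= subn0 scalerDl.
  apply: subalg_gen_add; first by rewrite -scalerA; apply: subalg_gen_scale.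
  by rewrite mulrC -scalerA; apply: subalg_gen_scale.
move=> p; split=> [|Yp]; last first.
  by apply/Xgen; apply: subalg_gen_trans Yp => y [Xy _]; apply: subalg_gen_mem.
move/std; apply: subalg_gen_trans => y y1.
have /Xgen/linear_part := cover_piece_algebra y1.
by have /cover_pieceP[r -> _] := y1; rewrite coef_scaleXn.
Qed.

(** Splittings into nonzero elements of the monoid of pairs (degree, cover); a
    pair is zero when [mdeg a + i] is.  Parts of degree 0 are allowed, hence an
    indecomposable cover is in particular minimal. *)
Definition decomposable k c := exists i j a b,
  [/\ k = (i + j)%N, c = (a + b)%MM, kcover D i a, kcover D j b
    & (0 < mdeg a + i)%N /\ (0 < mdeg b + j)%N].

(** Degree 0 is excluded because the scalars already provide the variables. *)
Definition indecomposable_monomial p := exists k c,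
  [/\ (0 < k)%N, kcover D k c, ~ decomposable k c & p = tmonomial k c].

Lemma indecomposable_monomial_piece p :
  indecomposable_monomial p -> exists k, cover_piece D k p.
Proof.
by case=> k [c [_ ck _ ->]]; exists k; apply: cover_piece_tmonomial.
Qed.

Lemma indecomposable_monomials_generate :
  generates indecomposable_monomial (cover_algebra D).
Proof.
move=> p; split; last first.
  exact: subalg_gen_cover_algebra indecomposable_monomial_piece _.
apply: cover_algebra_sub_gen => k c.
have [m] := ubnP (mdeg c + k); elim: m k c => // m IHm k c ltm ck.
have [->|k_gt0] := posnP k; first exact: tmonomial0.
have [[i [j [a [b [kE cE ai bj [ai0 bj0]]]]]]|indec] :=
  classic (decomposable k c).
  rewrite kE cE -tmonomialM; move: ltm; rewrite kE cE mdegD => ltm.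
  by apply: subalg_gen_mul; apply: IHm => //; lia.
by apply: subalg_gen_mem; exists k, c.
Qed.

(** If all generators are monomials, an indecomposable monomial can only enter
    the support of a product of elements of the algebra through one factor, the
    other one contributing its constant coefficient.  So it occurs in the
    generated algebra only if it is itself a generator. *)
Lemma indecomposable_monomials_minimal :
  minimal_homogeneous_generators (cover_piece D) (cover_algebra D)
    indecomposable_monomial.
Proof.
split; [exact: indecomposable_monomial_piece
       | exact: indecomposable_monomials_generate |].
move=> Y YX Ygen _ [k [c [k_gt0 ck indec ->]]].
have Yhom y : Y y -> exists i, cover_piece D i y.
  by move/YX; apply: indecomposable_monomial_piece.
have coverY := subalg_gen_cover_algebra Yhom.
suff occurs p : subalg_gen Y p -> c \in msupp p`_k -> Y (tmonomial k c).
  apply: (occurs (tmonomial k c)); last by rewrite msupp_tmonomial !eqxx.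
  by apply/Ygen; apply: cover_piece_algebra (cover_piece_tmonomial ck).
elim=> [a|y Yy|q r _ IHq _ IHr|q r Yq IHq Yr IHr].
- by rewrite coefZ coef1 gtn_eqF // mulr0 msupp0.
- have [j [d [_ _ _ yE]]] := YX y Yy.
  by rewrite yE msupp_tmonomial => /andP[/eqP-> /eqP->]; rewrite -yE.
- by rewrite coefD => /msuppD_le; rewrite mem_cat => /orP[/IHq|/IHr].
case/msupp_coefM=> i [j [a [b [kE cE qa rb]]]].
have ai := (cover_algebraP q).1 (coverY q Yq) i a qa.
have bj := (cover_algebraP r).1 (coverY r Yr) j b rb.
have [/eqP|a_pos] := posnP (mdeg a + i).
  rewrite addn_eq0 mdeg_eq0 => /andP[/eqP a0 /eqP i0].
  by apply: IHr; rewrite kE cE i0 a0 add0m.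
have [/eqP|b_pos] := posnP (mdeg b + j).
  rewrite addn_eq0 mdeg_eq0 => /andP[/eqP b0 /eqP j0].
  by apply: IHq; rewrite kE cE j0 b0 addn0 addm0.
by case: indec; exists i, j, a, b.
Qed.

End CoverAlgebra.

(** * The complex formed by a special odd cycle *)

Section OddCycle.

Variables (n : nat) (D : {set {set 'I_n}}).
Variables (s : nat) (v : 'I_s -> 'I_n) (F : 'I_s -> {set 'I_n}).
Hypotheses (s_odd : odd s) (vF_special : special_cycle D v F).
Hypothesis facetsD : facets D = [set F i | i : 'I_s].

Let V := [set v j | j : 'I_s].
Let one_V := [multinom (i \in V : nat) | i < n].

Let trace_cycle m : v m != v (ordS m) /\ F m :&: V = [set v m; v (ordS m)].
Proof.
have [[s_ge2 v_inj _ _ vF] cardFV] := vF_special.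
have vm : v m != v (ordS m).
  rewrite (inj_eq v_inj) -val_eqE /=; have := ltn_ord m.
  rewrite leq_eqVlt => /orP[/eqP mE|lt]; last by rewrite modn_small //; lia.
  by rewrite mE modnn; lia.
split=> //; apply/esym/eqP; rewrite eqEcard cards2 vm cardFV andbT.
have [v1 v2] := vF m.
by apply/subsetP => x /set2P[] ->; rewrite inE imset_f // andbT.
Qed.

Let weight_cycle m (a : 'X_{1..n}) : (forall x, x \notin V -> a x = 0%N) ->
  weight (F m) a = (a (v m) + a (v (ordS m)))%N.
Proof.
move=> a0; have [vm FV] := trace_cycle m.
rewrite /weight (big_setID V) /= FV big_setU1 ?big_set1 ?inE //=.
by rewrite [X in (_ + X)%N]big1 ?addn0 // => x; rewrite inE => /andP[/a0].
Qed.

Let one_V_v m : one_V (v m) = 1%N.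
Proof. by rewrite mnmE imset_f. Qed.

Lemma cycle_indicator_cover : kcover D 2 one_V.
Proof.
apply/kcoverP => G; rewrite facetsD => /imsetP[m _ ->].
rewrite weight_cycle ?one_V_v // => x xV; by rewrite mnmE (negPf xV).
Qed.

(** Up to symmetry, a splitting has degrees (1, 1) or (0, 2).  In the first
    case summing over the facets of the cycle counts each vertex twice, so both
    parts have total weight at least s/2; as s is odd, together they exceed the
    total weight s of the indicator.  In the second case the 2-cover is the
    whole indicator, which has weight exactly 2 on each facet of the cycle. *)
Lemma cycle_indicator_indecomposable : ~ decomposable D 2 one_V.
Proof.
case=> i [j [a [b [ij abE]]]] ai bj [a_pos b_pos].
have sumE x : one_V x = (a x + b x)%N by rewrite abE mnmDE.
have out x : x \notin V -> a x = 0%N /\ b x = 0%N.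
  by move=> xV; have := sumE x; rewrite mnmE (negPf xV); lia.
have wa m := @weight_cycle m a (fun x xV => (out x xV).1).
have wb m := @weight_cycle m b (fun x xV => (out x xV).2).
have FD m : F m \in facets D by case: vF_special => -[].
have ab m : (a (v m) + b (v m) = 1)%N by rewrite -sumE one_V_v.
have geai m : (i <= a (v m) + a (v (ordS m)))%N.
  by rewrite -wa (kcoverP _ _ _ ai).
have gebj m : (j <= b (v m) + b (v (ordS m)))%N.
  by rewrite -wb (kcoverP _ _ _ bj).
have [i0|i_gt0] := posnP i.
  suff a0 : a = 0%MM by rewrite a0 mdeg0 i0 in a_pos.
  apply/mnmP => x; rewrite mnm0E.
  have [/imsetP[m _ ->]|/out[]//] := boolP (x \in V).
  have := gebj m; have := ab m; have := ab (ordS m); lia.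
have [j0|j_gt0] := posnP j.
  suff b0 : b = 0%MM by rewrite b0 mdeg0 j0 in b_pos.
  apply/mnmP => x; rewrite mnm0E.
  have [/imsetP[m _ ->]|/out[]//] := boolP (x \in V).
  have := geai m; have := ab m; have := ab (ordS m); lia.
have double (d : 'X_{1..n}) : (forall m, 1 <= d (v m) + d (v (ordS m)))%N ->
    (s <= 2 * \sum_m d (v m))%N.
  move=> d1; rewrite mul2n -addnn [X in (_ + X)%N](reindex_inj (@ordS_inj s)).
  rewrite -big_split -[s in (s <= _)%N]card_ord -sum1_card.
  by apply: leq_sum => m _; apply: d1.
have total : (\sum_m a (v m) + \sum_m b (v m) = s)%N.
  rewrite -big_split -[RHS]card_ord -sum1_card.
  by apply: eq_bigr => m _; apply: ab.
have := double a (fun m => leq_trans i_gt0 (geai m)).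
have := double b (fun m => leq_trans j_gt0 (gebj m)).
move: s_odd total; lia.
Qed.

End OddCycle.

Lemma generator_of_special_odd_cycle (K : fieldType) n (D : {set {set 'I_n}})
    s (v : 'I_s -> 'I_n) (F : 'I_s -> {set 'I_n}) :
    odd s -> special_cycle D v F -> facets D = [set F i | i : 'I_s] ->
  ~ no_generator_of_degree_2 K D.
Proof.
move=> s_odd vF_special facetsD no_gen.
pose c := [multinom (i \in [set v j | j : 'I_s] : nat) | i < n].
have c2 : kcover D 2 c := cycle_indicator_cover s_odd vF_special facetsD.
apply: (no_gen _ (indecomposable_monomials_minimal K D) (tmonomial K 2 c)).
  exists 2%N, c; split=> //.
  exact: cycle_indicator_indecomposable s_odd vF_special.
exact: cover_piece_tmonomial.
Qed.

(** * Subcomplexes and the theorem *)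

Lemma special_cycle_facets n (D G : {set {set 'I_n}}) s (v : 'I_s -> 'I_n) F :
    (forall i, F i \in facets G) -> special_cycle D v F -> special_cycle G v F.
Proof. by move=> FG [[s2 vi Fi _ vF] FV]; do !split=> //; case: (vF i). Qed.

Lemma no_special_odd_cycle_subcomplex n (D G : {set {set 'I_n}}) :
  subcomplex G D -> ~ has_special_odd_cycle D -> ~ has_special_odd_cycle G.
Proof.
case=> _ /subsetP GD noD [s [v [F [s_odd vF]]]]; apply: noD; exists s, v, F.
split=> //; apply: special_cycle_facets (vF) => i; apply: GD.
by case: vF => -[].
Qed.

Definition generated_complex n (T : finType) (F : T -> {set 'I_n}) :
    {set {set 'I_n}} :=
  [set X : {set 'I_n} | [exists i, X \subset F i]].

(** Facets of a complex are pairwise incomparable, so all of the given ones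
    stay maximal in the complex that they generate. *)
Lemma facets_generated_complex n (D : {set {set 'I_n}}) (T : finType)
    (F : T -> {set 'I_n}) : (forall i, F i \in facets D) ->
  facets (generated_complex F) = [set F i | i : T].
Proof.
move=> FD; apply/setP => X; rewrite inE; apply/maxsetP/imsetP.
  case; rewrite inE => /existsP[i XF] Xmax; exists i => //.
  by apply/esym/Xmax => //; rewrite inE; apply/existsP; exists i.
case=> i _ ->; split; first by rewrite inE; apply/existsP; exists i.
move=> Y; rewrite inE => /existsP[j YF] FY.
have /maxsetP[_ Fmax] : maxset (fun X => X \in D) (F i).
  by have := FD i; rewrite inE.
have Fji : F j = F i.
  apply: Fmax; last exact: subset_trans FY YF.
  by have := FD j; rewrite inE => /maxsetP[].
by apply/eqP; rewrite eqEsubset FY -Fji YF.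
Qed.

Lemma subcomplex_generated_complex n (D : {set {set 'I_n}}) (T : finType)
    (F : T -> {set 'I_n}) (i0 : T) :
    simplicial_complex D -> (forall i, F i \in facets D) ->
  subcomplex (generated_complex F) D.
Proof.
move=> [_ _ D0] FD; have facetsG := facets_generated_complex FD.
have sub : facets (generated_complex F) \subset facets D.
  by rewrite facetsG; apply/subsetP => _ /imsetP[i _ ->].
split=> //; split.
- move=> X Y; rewrite !inE => /existsP[i XF] YX; apply/existsP; exists i.
  exact: subset_trans YX XF.
- by apply/set0Pn; exists (F i0); rewrite facetsG imset_f.
by apply: contra D0; apply: (subsetP sub).
Qed.

Theorem theorem2p2 (K : fieldType) (n : nat) (Delta : {set {set 'I_n}})
    (hDelta : simplicial_complex Delta) :
  [<-> forall Gamma : {set {set 'I_n}},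
         subcomplex Gamma Delta -> standard_graded K Gamma;
       forall Gamma : {set {set 'I_n}},
         subcomplex Gamma Delta -> no_generator_of_degree_2 K Gamma;
       ~ has_special_odd_cycle Delta].
Proof.
tfae.
- by move=> std G /std; apply: no_generator_of_standard_graded.
- move=> no_gen [s [v [F [s_odd vF]]]].
  have FD i : F i \in facets Delta by case: vF => -[].
  have i0 : 'I_s by exists 0%N; case: vF => -[]; lia.
  have facetsG := facets_generated_complex FD.
  apply: (generator_of_special_odd_cycle s_odd _ facetsG); last first.
    by apply: no_gen; apply: subcomplex_generated_complex.
  by apply: special_cycle_facets vF => i; rewrite facetsG imset_f.
move=> balanced G GD; apply: standard_graded_of_balanced.
exact: no_special_odd_cycle_subcomplex balanced.
Qed.
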